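(* Consider the optimization problem $(\mathrm{OP}\text{-}\epsilon)$ defined in the context with $\epsilon=0$, with optimal value $g(0)$. The following hold. (a) The problem has a finite optimal value, attained by some feasible solution with price vector $\mathbf p^0\ge 0$. (b) If an optimal price vector $\mathbf p^0$ prices some product $j$ at zero, then replacing $p^0_j$ by $\min_{i\in\{1,\dots,m\},\,k\in\{1,\dots,n\}}P_{ik}>0$ (other prices unchanged) does not lose optimality, i.e. the new price vector is also the price component of an optimal solution. (c) Let $\mathbf p^0>0$ be an optimal vector of positive prices, with products ordered so that $0<p^0_1\le p^0_2\le\dots\le p^0_n$. For any $\delta>0$, let $$\mathbf p'=\left(p^0_1-\frac{\delta'}{mn},\ p^0_2-2\frac{\delta'}{mn},\ p^0_3-3\frac{\delta'}{mn},\ \dots,\ p^0_n-n\frac{\delta'}{mn}\right)$$ for any sufficiently small $0<\delta'\le\delta$ so that $\mathbf p'>0$. Then $$0\ \le\ g(0)-m\tau^*\ \le\ g(0)-\sum_{i=1}^m f_i(\mathbf p')\ \le\ \delta ,$$ where $\tau^*=\sup_{\mathbf p\ge0}\frac1m\sum_{i=1}^m f_i(\mathbf p)$ is the optimal value of the original pricing problem.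
   Context: There are customers $\mathscr C=\{1,\dots,m\}$ and products $\mathscr P=\{1,\dots,n\}$. Customer $i$ saw historical prices $P_{ij}>0$ ($j\in\mathscr P$) and purchased product $c_i\in\mathscr P$. Let $P^{\max}=\max_{i}P_{ic_i}$. The incentive-compatible polyhedron of customer $i$ is $$\mathscr V_i=\{v\in\mathbb R^n_+:\ v_{c_i}-P_{ic_i}\ge0,\ v_{c_i}-P_{ic_i}\ge v_{j'}-P_{ij'}\ \forall j'\in\mathscr P\setminus\{c_i\}\}.$$ For $\mathbf p\in\mathbb R^n_+$, $f_i(\mathbf p)$ is the minimum of $r$ over $r\ge 0$ and $v\in\mathscr V_i$ such that at least one of the following holds: for some $j\in\mathscr P$, [$r=p_j$, $v_j-p_j\ge0$, and $v_j-p_j\ge v_{j'}-p_{j'}$ for all $j'\in\mathscr P$]; or [$r=0$ and $v_j-p_j\le0$ for all $j\in\mathscr P$]. Problem $(\mathrm{OP}\text{-}\epsilon)$: $g(\epsilon)$ is the maximum of $\sum_{i\in\mathscr C} y_{ic_i}\tau_i$ over $\mathbf p\in\mathbb R^n_+$, $\boldsymbol\tau\in\mathbb R^m_+$, $\mathbf y\in\{0,1\}^{m\times n}$ subject to $$\tau_i\le p_j+(1-y_{ij})P_{ic_i}\quad\forall i\in\mathscr C,\ j\in\mathscr P,$$ $$p_{c_i}\le P_{ic_i}+(P^{\max}-P_{ic_i})(1-y_{ic_i})-\epsilon\quad\forall i\in\mathscr C,$$ $$p_j-p_{c_i}\ge P_{ij}-P_{ic_i}-(P^{\max}+P_{ij}-P_{ic_i})y_{ij}+\epsilon\quad\forall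 i\in\mathscr C,\ j\in\mathscr P\setminus\{c_i\}.$$ A price vector is called optimal if it is the $\mathbf p$-component of an optimal solution. *)

(* Defs.v *)
From HB Require Import structures.
From mathcomp Require Import all_boot all_order all_algebra all_fingroup.
From mathcomp Require Import all_classical all_reals ereal.

Set Implicit Arguments.
Unset Strict Implicit.
Unset Printing Implicit Defensive.

Import Order.TTheory GRing.Theory Num.Theory.
Local Open Scope classical_set_scope.
Local Open Scope ring_scope.

(* Customers are 'I_m and products 'I_n; [P i j] is the historical price of
   product j seen by customer i, who purchased [c i]. *)

Definition Pmax (R : realType) (m n : nat) (P : 'M[R]_(m, n))
    (c : 'I_m -> 'I_n) : R :=
  (* prices are positive, so the default value 0 is neutral *)
  \big[Num.max/0]_(i < m) P i (c i).

Definition Pmin (R : realType) (m n : nat) (P : 'M[R]_(m, n))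
    (c : 'I_m -> 'I_n) : R :=
  (* for m > 0, [Pmax P c] is an entry of P, so it is a neutral default *)
  \big[Num.min/Pmax P c]_(ik : 'I_m * 'I_n) P ik.1 ik.2.

Definition nonneg_vec (R : realType) (n : nat) (p : 'rV[R]_n) : Prop :=
  forall j, 0 <= p 0 j.

Definition IC_polyhedron (R : realType) (m n : nat) (P : 'M[R]_(m, n))
    (c : 'I_m -> 'I_n) (i : 'I_m) : set 'rV[R]_n :=
  [set v | [/\ nonneg_vec v,
    0 <= v 0 (c i) - P i (c i) &
    forall j', j' != c i -> v 0 j' - P i j' <= v 0 (c i) - P i (c i)]].

Definition revenues (R : realType) (m n : nat) (P : 'M[R]_(m, n))
    (c : 'I_m -> 'I_n) (i : 'I_m) (p : 'rV[R]_n) : set R :=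
  [set r | 0 <= r /\ exists2 v, IC_polyhedron P c i v &
    (exists j, [/\ r = p 0 j, 0 <= v 0 j - p 0 j &
                   forall j', v 0 j' - p 0 j' <= v 0 j - p 0 j]) \/
    (r = 0 /\ forall j, v 0 j - p 0 j <= 0)].

(* The infimum is a minimum for p >= 0, see [worst_revenue_min]. *)
Definition worst_revenue (R : realType) (m n : nat) (P : 'M[R]_(m, n))
    (c : 'I_m -> 'I_n) (i : 'I_m) (p : 'rV[R]_n) : R :=
  inf (revenues P c i p).

Definition tau_star (R : realType) (m n : nat) (P : 'M[R]_(m, n))
    (c : 'I_m -> 'I_n) : \bar R :=
  ereal_sup [set (m%:R^-1 * \sum_(i < m) worst_revenue P c i p)%:E
            | p in [set p | nonneg_vec p]].

Definition OP_feasible (R : realType) (m n : nat) (P : 'M[R]_(m, n))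
    (c : 'I_m -> 'I_n) (eps : R)
    (p : 'rV[R]_n) (tau : 'rV[R]_m) (y : 'M[bool]_(m, n)) : Prop :=
  [/\ nonneg_vec p /\ nonneg_vec tau,
      forall i j, tau 0 i <= p 0 j + (1 - (y i j)%:R) * P i (c i),
      forall i, p 0 (c i) <=
        P i (c i) + (Pmax P c - P i (c i)) * (1 - (y i (c i))%:R) - eps &
      forall i j, j != c i -> p 0 j - p 0 (c i) >=
        P i j - P i (c i)
        - (Pmax P c + P i j - P i (c i)) * (y i j)%:R + eps].

Definition OP_objective (R : realType) (m n : nat) (c : 'I_m -> 'I_n)
    (tau : 'rV[R]_m) (y : 'M[bool]_(m, n)) : R :=
  \sum_(i < m) (y i (c i))%:R * tau 0 i.

Definition OP_value (R : realType) (m n : nat) (P : 'M[R]_(m, n))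
    (c : 'I_m -> 'I_n) (eps : R) : \bar R :=
  ereal_sup [set x | exists p tau y,
    OP_feasible P c eps p tau y /\ x = (OP_objective c tau y)%:E].

Definition OP_optimal (R : realType) (m n : nat) (P : 'M[R]_(m, n))
    (c : 'I_m -> 'I_n) (eps : R)
    (p : 'rV[R]_n) (tau : 'rV[R]_m) (y : 'M[bool]_(m, n)) : Prop :=
  OP_feasible P c eps p tau y /\ (OP_objective c tau y)%:E = OP_value P c eps.

Definition optimal_price (R : realType) (m n : nat) (P : 'M[R]_(m, n))
    (c : 'I_m -> 'I_n) (eps : R) (p : 'rV[R]_n) : Prop :=
  exists tau y, OP_optimal P c eps p tau y.

Definition set_price (R : realType) (n : nat) (p : 'rV[R]_n) (j : 'I_n)
    (x : R) : 'rV[R]_n :=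
  \row_k (if k == j then x else p 0 k).

(* [rk j] is the position of product j, counted from 0, in an ordering of the
   products by nondecreasing price. *)
Definition sorting_rank (R : realType) (n : nat) (p : 'rV[R]_n)
    (rk : 'S_n) : Prop :=
  forall j k, (rk j <= rk k)%N -> p 0 j <= p 0 k.

Definition perturbed_price (R : realType) (m n : nat) (p : 'rV[R]_n)
    (rk : 'S_n) (d : R) : 'rV[R]_n :=
  \row_j (p 0 j - (rk j).+1%:R * (d / (m * n)%:R)).

Lemma worst_revenue_min (R : realType) (m n : nat) (P : 'M[R]_(m, n))
    (c : 'I_m -> 'I_n) (i : 'I_m) (p : 'rV[R]_n) :
    (forall j, 0 < P i j) -> nonneg_vec p ->
  revenues P c i p (worst_revenue P c i p) /\
  lbound (revenues P c i p) (worst_revenue P c i p).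
Proof.
move=> P0 p0; rewrite /worst_revenue; set S := revenues P c i p.
have lb0 : lbound S 0 by move=> r [].
pose v := row i P.
have Vv : IC_polyhedron P c i v.
  by split=> [j||j' _]; rewrite !mxE ?subrr // ltW.
have S0 : S !=set0.
  have [/existsP[j0 j0P]|/existsPn H] := boolP [exists j, 0 < v 0 j - p 0 j].
    pose j := [arg max_(k > j0) (v 0 k - p 0 k)]%O.
    have jP k : v 0 k - p 0 k <= v 0 j - p 0 j.
      by rewrite /j; case: arg_maxP => // j1 _; apply.
    exists (p 0 j); split; first exact: p0.
    by exists v => //; left; exists j; split=> //; rewrite (le_trans _ (jP j0)) ?ltW.
  by exists 0; split=> //; exists v => //; right; split=> // j; rewrite leNgt.
have Slb : lbound S (inf S) by move=> r Sr; apply: ge_inf => //; exists 0.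
split=> //.
pose s := 0 :: [seq p 0 j | j <- enum 'I_n].
have Ss r : S r -> r \in s.
  case=> _ [w _ [[j [-> _ _]]|[-> _]]]; rewrite inE ?eqxx //.
  by rewrite map_f ?orbT // mem_enum.
have [r0 Sr0] := S0.
pose i0 := Ordinal (etrans (index_mem r0 s) (Ss _ Sr0)).
have Pi0 : `[< S (nth 0 s i0) >] by apply/asboolP; rewrite nth_index // Ss.
case: (@arg_minP _ _ _ i0 (fun k : 'I_(size s) => `[< S (nth 0 s k) >])
  (fun k => nth 0 s k) Pi0) => k /asboolP Sk kmin.
suff -> : inf S = nth 0 s k by [].
apply/eqP; rewrite eq_le Slb //=; apply: lb_le_inf => // r Sr.
have rs := Ss _ Sr; have ltr : (index r s < size s)%N by rewrite index_mem.
have := kmin (Ordinal ltr); rewrite /= nth_index //; apply.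
exact/asboolP.
Qed.

(* Main.v *)
Require Import Defs.
From mathcomp Require Import all_boot all_order all_algebra all_fingroup.
From mathcomp Require Import all_classical all_reals ereal.
From mathcomp Require Import ring lra.

(** Why the theorem holds.

    Call customer [i] a certain buyer at prices [p] when
    [p (c i) < P i (c i)]: every valuation compatible with the past purchase
    then leaves a positive surplus on [c i], so something is bought.  Such a
    customer can be brought to buy [j] exactly when [j] did not lose
    attractiveness relative to [c i], that is
    [p j - p (c i) <= P i j - P i (c i)]; so the worst revenue is the least
    [p j] over these [j], and it is zero for the other customers
    ([worst_revenue_priced_out], [worst_revenue_le_price],
    [worst_revenue_ge]).

    The mixed-integer program describes the same quantity up to ties.  A
    customer is counted when [y i (c i)] holds, and the products with [y i j],
    called marked, are those whose price caps the revenue [tau i].  The last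
    constraint makes the mark compulsory when the displayed inequality is
    strict; on a tie the program may leave [j] unmarked, and it may count a
    customer with [p (c i) = P i (c i)].  Its value is therefore an upper bound
    on the total worst revenue ([OP_value_ge_worst]).

    (c) The bound is nearly tight, because ties can be broken in favour of the
    seller.  Lowering prices by amounts that grow with the price rank makes
    every counted customer a certain buyer, and an unmarked product [j] that
    still competes with [c i] afterwards has a rank at least that of [c i],
    hence an original price at least [p (c i)].  On no customer is more lost
    than the largest reduction, which is [1 / m] of the total allowance
    ([perturbed_worst_ge]).

    (a) For fixed [y] the constraints are stable under componentwise suprema,
    once the prices are capped, so a greatest feasible point exists and is
    optimal for this [y] ([choice_max_attained]); there are finitely many [y].

    (b) If the price of [j] is zero, the customers with [c i = j] and those
    who have [j] marked contribute nothing.  Raising this price relaxes the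
    constraints of every customer with [c i <> j], and those with [c i = j]
    can be declared not counted ([optimal_raise_zero_price]). *)

Set Implicit Arguments.
Unset Strict Implicit.
Unset Printing Implicit Defensive.

Import Order.TTheory GRing.Theory Num.Theory.
Local Open Scope classical_set_scope.
Local Open Scope ring_scope.

(** * The program as a system of difference constraints *)

(** Splitting on the entries of [y] shows that every constraint bounds one
    variable by another one plus a constant, or by a constant.  This shape is
    what makes capping and componentwise suprema preserve feasibility. *)
Lemma OP_feasible0P (R : realType) (m n : nat) (P : 'M[R]_(m, n))
    (c : 'I_m -> 'I_n) (p : 'rV[R]_n) (tau : 'rV[R]_m) (y : 'M[bool]_(m, n)) :
  OP_feasible P c 0 p tau y <->
  [/\ nonneg_vec p /\ nonneg_vec tau,
      forall i j, tau 0 i <= p 0 j + (if y i j then 0 else P i (c i)),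
      forall i, p 0 (c i) <= (if y i (c i) then P i (c i) else Pmax P c) &
      forall i j, j != c i ->
        p 0 (c i) <= p 0 j + (if y i j then Pmax P c else P i (c i) - P i j)].
Proof.
split=> -[nneg Htau Hsell Hrank]; split=> //.
- by move=> i j; have := Htau i j; case: (y i j) => /=; lra.
- by move=> i; have := Hsell i; case: (y i (c i)) => /=; lra.
- by move=> i j /(Hrank i j); case: (y i j) => /=; lra.
- by move=> i j; have := Htau i j; case: (y i j) => /=; lra.
- by move=> i; have := Hsell i; case: (y i (c i)) => /=; lra.
- by move=> i j /(Hrank i j); case: (y i j) => /=; lra.
Qed.

Section Pricing.

Variables (R : realType) (m n : nat) (P : 'M[R]_(m, n)) (c : 'I_m -> 'I_n).
Hypothesis P_gt0 : forall i j, 0 < P i j.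

Implicit Types (p : 'rV[R]_n) (tau : 'rV[R]_m) (y : 'M[bool]_(m, n)).

Local Notation feasible := (OP_feasible P c 0).
Local Notation objective := (OP_objective c).
Local Notation worst := (worst_revenue P c).

Lemma le_Pmax i : P i (c i) <= Pmax P c.
Proof. exact: (le_bigmax _ (fun i => P i (c i))). Qed.

Lemma Pmax_ge0 : 0 <= Pmax P c.
Proof. exact: bigmax_ge_id. Qed.

Lemma Pmin_gt0 : (0 < m)%N -> 0 < Pmin P c.
Proof.
move=> m_gt0; apply/bigmin_gtP; split=> [|[i k] _]; last exact: P_gt0.
exact: lt_le_trans (P_gt0 _ _) (le_Pmax (Ordinal m_gt0)).
Qed.

Lemma Pmin_le_Pmax : Pmin P c <= Pmax P c.
Proof. exact: bigmin_le_id. Qed.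

Lemma feasible_le_Pmax p tau y i : feasible p tau y -> p 0 (c i) <= Pmax P c.
Proof.
case/OP_feasible0P=> _ _ /(_ i) + _; case: ifP => // _ /le_trans->//.
exact: le_Pmax.
Qed.

Lemma OP_value_ge p tau y :
  feasible p tau y -> ((objective tau y)%:E <= OP_value P c 0)%E.
Proof. by move=> feas; apply: ereal_sup_ubound; exists p, tau, y. Qed.

(** * Attainment of the optimal value *)

(** A price above this level is never forced: purchased products cost at most
    [Pmax P c], a constraint lifts another price above these by at most an entry
    of [P], and a revenue is at most [2 * Pmax P c].  The default
    [Pmax P c] of the maximum serves this last bound. *)
Definition price_cap : R :=
  Pmax P c + \big[Num.max/Pmax P c]_(ik : 'I_m * 'I_n) P ik.1 ik.2.

(** The program leaves the prices of never purchased products unbounded above;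
    capping makes the suprema in [choice_max_attained] finite. *)
Lemma feasible_cap p tau y : feasible p tau y ->
  feasible (\row_j Num.min (p 0 j) price_cap) tau y.
Proof.
move=> feas; have pmax i := feasible_le_Pmax i feas.
have Pij i j : P i j <= price_cap - Pmax P c.
  rewrite addrAC subrr add0r.
  exact: (le_bigmax _ (fun ik => P ik.1 ik.2) (i, j)).
have PM : Pmax P c <= price_cap - Pmax P c.
  by rewrite addrAC subrr add0r; exact: bigmax_ge_id.
have PM0 := Pmax_ge0.
have /OP_feasible0P[[p0 t0] Htau Hsell Hrank] := feas.
apply/OP_feasible0P; split.
- by split=> // j; rewrite mxE le_min p0 /=; lra.
- move=> i j; rewrite mxE; have := Htau i j.
  have := Htau i (c i); have := Hsell i; have := pmax i; have := le_Pmax i.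
  have := P_gt0 i (c i).
  by case: (y i j); case: (y i (c i)); rewrite minEle; case: ifP => _; lra.
- by move=> i; rewrite mxE; apply: le_trans (Hsell i); rewrite ge_min lexx.
- move=> i j jc; rewrite !mxE; have := Hrank i j jc; have := pmax i.
  have := Pij i j; have := P_gt0 i (c i).
  rewrite (min_l (y:=price_cap)); last by have := pmax i; lra.
  by rewrite minEle; case: (y i j); case: ifP => _; lra.
Qed.

Lemma feasible_tau_le p tau y i :
  feasible p tau y -> tau 0 i <= Pmax P c + Pmax P c.
Proof.
move=> feas; have := feasible_le_Pmax i feas; have := le_Pmax i.
have := P_gt0 i (c i); have /OP_feasible0P[_ /(_ i (c i)) + _ _] := feas.
by case: (y i (c i)); lra.
Qed.

(** Systems of constraints [u <= w + k] and [u <= k], with [u] and [w] single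
    variables and [k] constant, are stable under componentwise suprema: each
    admissible [u] is below some [w + k], hence below the supremum of [w] plus
    [k].  The supremum of all capped feasible points is thus feasible, and it is
    best because the objective is nondecreasing in each revenue. *)
Lemma choice_max_attained y : (exists p tau, feasible p tau y) ->
  exists p tau, feasible p tau y /\
    forall p' tau', feasible p' tau' y -> objective tau' y <= objective tau y.
Proof.
move=> [p1 [tau1 feas1]].
pose S := [set x : 'rV[R]_n * 'rV[R]_m |
  feasible x.1 x.2 y /\ forall j, x.1 0 j <= price_cap].
have capS p tau : feasible p tau y -> S (\row_j Num.min (p 0 j) price_cap, tau).
  by move=> /feasible_cap feas; split=> //= j; rewrite mxE ge_min lexx orbT.
have S1 := capS _ _ feas1.
pose ps : 'rV[R]_n := \row_j sup [set x.1 0 j | x in S].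
pose ts : 'rV[R]_m := \row_i sup [set x.2 0 i | x in S].
have ps_ub x j : S x -> x.1 0 j <= ps 0 j.
  move=> Sx; rewrite mxE; apply: ub_le_sup; last by exists x.
  by exists price_cap => _ [z [_ zM] <-].
have ts_ub x i : S x -> x.2 0 i <= ts 0 i.
  move=> Sx; rewrite mxE; apply: ub_le_sup; last by exists x.
  by exists (Pmax P c + Pmax P c) => _ [z [/feasible_tau_le + _] <-]; apply.
have ps_lub j b : (forall x, S x -> x.1 0 j <= b) -> ps 0 j <= b.
  move=> Sb; rewrite mxE; apply: ge_sup; first by do 2!eexists; first exact: S1.
  by move=> _ [x Sx <-]; apply: Sb.
have ts_lub i b : (forall x, S x -> x.2 0 i <= b) -> ts 0 i <= b.
  move=> Sb; rewrite mxE; apply: ge_sup; first by do 2!eexists; first exact: S1.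
  by move=> _ [x Sx <-]; apply: Sb.
have feasS x : S x -> feasible x.1 x.2 y by case.
exists ps, ts; split; last first.
  move=> p tau /capS Sx; apply: ler_sum => i _; apply: ler_wpM2l => //.
  exact: ts_ub Sx.
apply/OP_feasible0P; split.
- have /feasS/OP_feasible0P[[p0 t0] _ _ _] := S1.
  by split=> k; [apply: le_trans (ps_ub _ k S1)|apply: le_trans (ts_ub _ k S1)].
- move=> i j; apply: ts_lub => x Sx.
  have /OP_feasible0P[_ /(_ i j)/le_trans + _ _] := feasS x Sx; apply.
  by rewrite lerD2r ps_ub.
- by move=> i; apply: ps_lub => x /feasS/OP_feasible0P[_ _ /(_ i)].
- move=> i j jc; apply: ps_lub => x Sx.
  have /OP_feasible0P[_ _ _ /(_ i j jc)/le_trans] := feasS x Sx; apply.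
  by rewrite lerD2r ps_ub.
Qed.

(** With nobody counted and every product but [c i] marked, the constraints on
    prices are at their loosest. *)
Lemma zero_feasible : feasible 0 0 (\matrix_(i, j) (j != c i)).
Proof.
apply/OP_feasible0P; split.
- by split=> k; rewrite mxE.
- by move=> i j; rewrite !mxE; case: ifP => // _; rewrite add0r ltW.
- by move=> i; rewrite !mxE eqxx /= Pmax_ge0.
- by move=> i j jc; rewrite !mxE jc add0r Pmax_ge0.
Qed.

Lemma max_attained : exists p tau y, feasible p tau y /\
  forall p' tau' y', feasible p' tau' y' ->
    objective tau' y' <= objective tau y.
Proof.
pose good y := `[< exists p tau, feasible p tau y >].
have /choice[best bestP] y : exists x : 'rV[R]_n * 'rV[R]_m, good y ->
    feasible x.1 x.2 y /\
    forall p' tau', feasible p' tau' y -> objective tau' y <= objective x.2 y.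
  have [/asboolP/choice_max_attained[p [tau H]]|_] := boolP (good y).
    by exists (p, tau).
  by exists (0, 0).
have good0 : good (\matrix_(i, j) (j != c i)).
  by apply/asboolP; exists 0, 0; exact: zero_feasible.
case: (@arg_maxP _ _ _ _ good (fun y => objective (best y).2 y) good0).
move=> y gy ymax; have [feas _] := bestP y gy.
exists (best y).1, (best y).2, y; split=> // p' tau' y' feas'.
have gy' : good y' by apply/asboolP; exists p', tau'.
by have [_ /(_ _ _ feas')/le_trans] := bestP y' gy'; apply; apply: ymax.
Qed.

Lemma OP_value_attained : exists p tau y, OP_optimal P c 0 p tau y.
Proof.
have [p [tau [y [feas best]]]] := max_attained.
exists p, tau, y; split=> //; apply/le_anti/andP; split.
  exact: OP_value_ge feas.
apply: ge_ereal_sup => _ [p' [tau' [y' [feas' ->]]]].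
by rewrite lee_fin; exact: best feas'.
Qed.

Lemma OP_value_fin_num : OP_value P c 0 \is a fin_num.
Proof. by have [p [tau [y [_ <-]]]] := OP_value_attained. Qed.

(** * Raising a zero price *)

Lemma optimal_price_improve p tau y p' tau' y' :
  OP_optimal P c 0 p tau y -> feasible p' tau' y' ->
  (forall i, (y i (c i))%:R * tau 0 i <= (y' i (c i))%:R * tau' 0 i) ->
  optimal_price P c 0 p'.
Proof.
move=> [_ opt] feas' le_i; exists tau', y'; split=> //.
apply/le_anti; rewrite (OP_value_ge feas') -opt lee_fin /=.
by apply: ler_sum => i _; apply: le_i.
Qed.

(** The row of a customer with [c i = j] is reset to not counted: after the
    price increase such a customer might violate [p (c i) <= P i (c i)], and
    nothing was earned there before.  The other rows stay feasible, since [p j]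
    occurs in them only on the side where an increase helps. *)
Lemma optimal_raise_zero_price p j x :
  optimal_price P c 0 p -> p 0 j = 0 -> 0 <= x <= Pmax P c ->
  optimal_price P c 0 (set_price p j x).
Proof.
move=> [tau [y opt]] pj0 /andP[x0 xM].
have [feas _] := opt.
have /OP_feasible0P[[p0 t0] Htau Hsell Hrank] := feas.
pose tau' : 'rV[R]_m := \row_i (if c i == j then 0 else tau 0 i).
pose y' : 'M[bool]_(m, n) :=
  \matrix_(i, k) (if c i == j then k != c i else y i k).
have p_le k : p 0 k <= set_price p j x 0 k.
  by rewrite mxE; case: eqP => // ->; rewrite pj0.
have p_ne k : k != j -> set_price p j x 0 k = p 0 k.
  by rewrite mxE => /negbTE ->.
apply: (optimal_price_improve (tau' := tau') (y' := y') opt).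
  apply/OP_feasible0P; split.
  - split=> k; first exact: le_trans (p_le k).
    by rewrite mxE; case: ifP.
  - move=> i k; rewrite !mxE; have := p_le k; rewrite mxE.
    have := p0 k; have := P_gt0 i (c i).
    case: (c i == j); first by case: (k != c i); lra.
    by have := Htau i k; lra.
  - move=> i; rewrite [y' _ _]mxE; have [cij|cij] := boolP (c i == j).
      by rewrite eqxx mxE cij.
    by rewrite p_ne.
  - move=> i k kc; rewrite [y' _ _]mxE; have := p_le k.
    have [cij|cij] := boolP (c i == j).
      rewrite kc [set_price p j x 0 (c i)]mxE cij; have := p0 k; lra.
    by rewrite (p_ne (c i)) //; have := Hrank i k kc; lra.
move=> i; rewrite !mxE; have [cij|//] := ifPn.
have := Htau i j; rewrite (eqP cij) pj0 eqxx mulr0.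
by case: (y i j); rewrite ?mul0r ?mul1r ?addr0.
Qed.

(** * The worst revenue of a customer *)

Lemma worst_revenue_le i p r :
  nonneg_vec p -> revenues P c i p r -> worst i p <= r.
Proof. by move=> p0; have [_] := worst_revenue_min c (P_gt0 i) p0; apply. Qed.

Lemma worst_revenue_ge0 i p : nonneg_vec p -> 0 <= worst i p.
Proof. by move=> p0; have [[]] := worst_revenue_min c (P_gt0 i) p0. Qed.

(** The adverse valuation is the historical price on [c i] and zero elsewhere:
    it leaves no positive surplus anywhere. *)
Lemma worst_revenue_priced_out i p :
  nonneg_vec p -> P i (c i) <= p 0 (c i) -> worst i p <= 0.
Proof.
move=> p0 pc; apply: worst_revenue_le => //; split=> //.
exists (\row_j if j == c i then P i j else 0).
  split=> [j||j jc]; rewrite !mxE ?eqxx ?subrr //.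
    by case: ifP => // _; apply: ltW.
  by rewrite (negbTE jc) sub0r oppr_le0 ltW.
by right; split=> // j; rewrite mxE; case: eqP => [->|_]; [|have := p0 j]; lra.
Qed.

(** The adverse valuation equals the historical price on [c i] and on [j], and
    zero elsewhere: the past choice is a tie between the two products, while now
    [j] has at least the surplus of [c i]. *)
Lemma worst_revenue_le_price i p j : nonneg_vec p ->
  p 0 (c i) <= P i (c i) -> p 0 j - p 0 (c i) <= P i j - P i (c i) ->
  worst i p <= p 0 j.
Proof.
move=> p0 pc pj; apply: worst_revenue_le => //; split=> //.
exists (\row_k if (k == c i) || (k == j) then P i k else 0).
  split=> [k||k kc]; rewrite !mxE ?eqxx ?subrr //.
    by case: ifP => // _; apply: ltW.
  by case: ifP; have := P_gt0 i k; lra.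
left; exists j; split=> // [|k]; rewrite !mxE eqxx orbT; first lra.
by case: eqP => [->|_] /=; [|case: eqP => [->|_]]; have := p0 k; lra.
Qed.

(** Not buying is excluded by the positive surplus on [c i].  If [j] is bought,
    the past and the present comparisons with [c i] bound the same difference
    [v j - v (c i)] from both sides. *)
Lemma worst_revenue_ge i p r : nonneg_vec p ->
  p 0 (c i) < P i (c i) ->
  (forall j, p 0 j - p 0 (c i) <= P i j - P i (c i) -> r <= p 0 j) ->
  r <= worst i p.
Proof.
move=> p0 pc r_le.
have [[_ [v [v0 vc vj]] [[j [-> _ /(_ (c i)) vjc]]|[_ vle]]] _] :=
  worst_revenue_min c (P_gt0 i) p0.
  apply: r_le; have [->|/vj] := eqVneq j (c i); first lra.
  by lra.
by have := vle (c i); lra.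
Qed.

(** * The program against the worst revenue *)

(** Prices above [Pmax P c] are infeasible for purchased products, so they are
    capped there.  Certain buyers are counted with the compulsory marks and
    [tau i] the worst revenue.  Capping may create new marks, but only on
    products priced [Pmax P c], which exceeds what a certain buyer ever pays;
    the other marked products compete with [c i] at the original prices too. *)
Lemma OP_value_ge_worst p : nonneg_vec p ->
  ((\sum_(i < m) worst i p)%:E <= OP_value P c 0)%E.
Proof.
move=> p0.
pose q : 'rV[R]_n := \row_j Num.min (p 0 j) (Pmax P c).
pose tau : 'rV[R]_m := \row_i worst i p.
pose y : 'M[bool]_(m, n) := \matrix_(i, j)
  if p 0 (c i) < P i (c i)
  then (j == c i) || (q 0 j - q 0 (c i) < P i j - P i (c i)) else j != c i.
have qc i : p 0 (c i) < P i (c i) -> q 0 (c i) = p 0 (c i).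
  by move=> pc; rewrite mxE min_l //; have := le_Pmax i; lra.
have tau_out i : P i (c i) <= p 0 (c i) -> tau 0 i <= 0.
  by rewrite mxE; exact: worst_revenue_priced_out.
have tau_in i : p 0 (c i) < P i (c i) -> tau 0 i <= p 0 (c i).
  move=> pc; rewrite mxE.
  by apply: worst_revenue_le_price; rewrite ?subrr ?(ltW pc).
have q0 j : 0 <= q 0 j by rewrite mxE le_min p0 Pmax_ge0.
have feas : feasible q tau y.
  apply/OP_feasible0P; split.
  - by split=> // i; rewrite mxE worst_revenue_ge0.
  - move=> i j; rewrite [y _ _]mxE.
    have := q0 j; have := P_gt0 i (c i).
    have [pc|/tau_out] := ltP (p 0 (c i)) (P i (c i)); last first.
      by case: (j != c i); lra.
    have := tau_in _ pc; have := le_Pmax i.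
    have [->|jc] := eqVneq j (c i); first by rewrite /= qc //; lra.
    rewrite /= qc //; case: ifP => [|_]; last lra.
    rewrite [q 0 j]mxE minEle; case: ifP => _; last lra.
    move=> /ltW pj _ _ _ _; rewrite addr0 mxE.
    by apply: worst_revenue_le_price => //; exact: ltW.
  - move=> i; rewrite [y _ _]mxE eqxx.
    case: ltP => [pc|_] /=; first by rewrite qc // ltW.
    by rewrite mxE ge_min lexx orbT.
  - move=> i j jc; rewrite [y _ _]mxE (negbTE jc) /=.
    have qM : q 0 (c i) <= Pmax P c by rewrite mxE ge_min lexx orbT.
    have := q0 j.
    case: (p 0 (c i) < P i (c i)); last by lra.
    by case: ltP; lra.
apply: le_trans (OP_value_ge feas); rewrite lee_fin; apply: ler_sum => i _.
rewrite [y _ _]mxE [tau 0 i]mxE eqxx /=.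
by case: ltP => [_|/(worst_revenue_priced_out p0)]; rewrite ?mul1r ?mul0r.
Qed.

Lemma m_tau_starE : (0 < m)%N -> (m%:R%:E * tau_star P c)%E =
  ereal_sup [set (\sum_(i < m) worst i p)%:E | p in @nonneg_vec R n].
Proof.
move=> m_gt0; rewrite /tau_star -ereal_sup_pZl ?ltr0n // image_comp.
congr ereal_sup; apply: eq_imagel => p _ /=.
by rewrite -EFinM mulrA divff ?mul1r // pnatr_eq0 -lt0n.
Qed.

(** Three kinds of products could yield the worst revenue at the perturbed
    prices.  For [c i] and for marked products, [tau i] is below the original
    price.  An unmarked product satisfied [p j - p (c i) >= P i j - P i (c i)]
    before; if it competes now, its price was reduced at least as much as that
    of [c i], so it ranks no lower and was no cheaper.  In each case at most the
    largest reduction, [d / m], separates [tau i] from the perturbed price. *)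
Lemma perturbed_worst_ge p tau y (rk : 'S_n) d i :
  feasible p tau y -> sorting_rank p rk -> 0 < d ->
  nonneg_vec (perturbed_price m p rk d) ->
  (y i (c i))%:R * tau 0 i - d / m%:R
    <= worst i (perturbed_price m p rk d).
Proof.
move=> /OP_feasible0P[[p0 t0] Htau Hsell Hrank] srk d0 p'0.
have m0 : 0 < m%:R :> R by rewrite ltr0n; case: m i => [[]|].
have n0 : 0 < n%:R :> R by rewrite ltr0n; case: n (c i) => [[]|].
set p' := perturbed_price m p rk d in p'0 *.
(* The reduction per rank; the highest rank is reduced by n * e = d / m. *)
pose e := d / (m * n)%:R.
have e0 : 0 < e by rewrite divr_gt0 // natrM mulr_gt0.
have p'E j : p' 0 j = p 0 j - (rk j).+1%:R * e by rewrite mxE.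
have p'_ge j : p 0 j - d / m%:R <= p' 0 j.
  rewrite p'E lerD2l lerN2 (_ : d / m%:R = n%:R * e).
    by rewrite ler_pM2r // ler_nat.
  by rewrite /e natrM; field; rewrite !gt_eqF.
have := Hsell i; have := Htau i (c i).
have [yc tauc pc|_ _ _] := boolP (y i (c i)); last first.
  rewrite mul0r; apply: le_trans (worst_revenue_ge0 i p'0).
  by rewrite sub0r oppr_le0 divr_ge0 ?ltW.
rewrite mul1r; rewrite addr0 in tauc; apply: worst_revenue_ge => //.
  rewrite p'E; have : 0 < (rk (c i)).+1%:R * e by rewrite mulr_gt0.
  by lra.
move=> j; have := p'_ge j; have := Htau i j; have := Hrank i j.
have [->|jc /(_ isT)] := eqVneq j (c i); first by lra.
case: (y i j); first by lra.
move=> pj _ p'j; rewrite !p'E => kept.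
have rk_le : (rk (c i) <= rk j)%N.
  have : (rk (c i)).+1%:R * e <= (rk j).+1%:R * e by lra.
  by rewrite ler_pM2r // ler_nat ltnS.
by have := srk _ _ rk_le; rewrite -p'E; lra.
Qed.

End Pricing.

Theorem theorem2 (R : realType) (m n : nat) (P : 'M[R]_(m, n))
    (c : 'I_m -> 'I_n) (m_gt0 : (0 < m)%N) (P_gt0 : forall i j, 0 < P i j) :
  [/\ OP_value P c 0 \is a fin_num /\
      (exists p tau y, OP_optimal P c 0 p tau y),
      0 < Pmin P c /\
      (forall (p0 : 'rV[R]_n) (j : 'I_n),
         optimal_price P c 0 p0 -> p0 0 j = 0 ->
         optimal_price P c 0 (set_price p0 j (Pmin P c))) &
      forall (p0 : 'rV[R]_n) (rk : 'S_n),
        optimal_price P c 0 p0 -> (forall j, 0 < p0 0 j) ->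
        sorting_rank p0 rk ->
        forall delta delta' : R, 0 < delta -> 0 < delta' <= delta ->
        let p' := perturbed_price m p0 rk delta' in
        (forall j, 0 < p' 0 j) ->
        [/\ (0 <= OP_value P c 0 - m%:R%:E * tau_star P c)%E,
            (OP_value P c 0 - m%:R%:E * tau_star P c <=
             OP_value P c 0 - (\sum_(i < m) worst_revenue P c i p')%:E)%E &
            (OP_value P c 0 - (\sum_(i < m) worst_revenue P c i p')%:E
             <= delta%:E)%E]].
Proof.
have fing := OP_value_fin_num c P_gt0.
have minP := Pmin_gt0 c P_gt0 m_gt0.
split; first by split=> //; exact: OP_value_attained.
  split=> // p0 j opt pj0; apply: optimal_raise_zero_price => //.
  by rewrite ltW // Pmin_le_Pmax.
move=> p0 rk [tau [y [feas opt]]] _ srk delta delta' _ /andP[d0 dd] p' p'0.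
have p'ge0 : nonneg_vec p' by move=> j; apply: ltW.
rewrite m_tau_starE //; split.
- rewrite sube_ge0 ?fing ?orbT //; apply: ge_ereal_sup => _ [p pge0 <-].
  exact: OP_value_ge_worst.
- by apply: leeB => //; apply: ereal_sup_ubound; exists p'.
- rewrite -opt -EFinB lee_fin; apply: le_trans dd.
  rewrite lerBlDr addrC -lerBlDr.
  have -> : delta' = \sum_(i < m) delta' / m%:R.
    by rewrite sumr_const card_ord -[_ *+ m]mulr_natr divfK // pnatr_eq0 -lt0n.
  rewrite -sumrB; apply: ler_sum => i _.
  exact: perturbed_worst_ge feas srk d0 p'ge0.
Qed.
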